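(* If the plant is open-loop stable, i.e., if $A$ is stable, then $\mathcal{C}_n$ is path-connected.
   Context: Fix integers $n,m,p\ge 1$, real matrices $A\in\mathbb{R}^{n\times n}$, $B\in\mathbb{R}^{n\times m}$, $C\in\mathbb{R}^{p\times n}$ (the plant $\dot x=Ax+Bu+w$, $y=Cx+v$), and real symmetric matrices $W\succeq 0$ ($n\times n$), $V\succ 0$ ($p\times p$), $Q\succeq 0$ ($n\times n$), $R\succ 0$ ($m\times m$). Standing assumption: $(A,B)$ and $(A,W^{1/2})$ are controllable, and $(C,A)$ and $(Q^{1/2},A)$ are observable. A real square matrix is called stable if all its eigenvalues have negative real part. The set of full-order strictly proper stabilizing controllers is $$\mathcal{C}_n=\left\{\mathsf{K}=\begin{bmatrix}0_{m\times p}&C_{\mathsf K}\\ B_{\mathsf K}&A_{\mathsf K}\end{bmatrix}\in\mathbb{R}^{(m+n)\times(p+n)}\ \middle|\ A_{\mathsf K}\in\mathbb{R}^{n\times n},\,B_{\mathsf K}\in\mathbb{R}^{n\times p},\,C_{\mathsf K}\in\mathbb{R}^{m\times n},\ \begin{bmatrix}A&BC_{\mathsf K}\\ B_{\mathsf K}C&A_{\mathsf K}\end{bmatrix}\text{ is stable}\right\},$$ with the topology induced from the Euclidean space of matrices. *)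

(* Defs.v *)
From HB Require Import structures.
From mathcomp Require Import all_boot all_order all_algebra.
From mathcomp Require Import all_classical all_reals all_analysis.
From mathcomp Require Import complex.

Set Implicit Arguments.
Unset Strict Implicit.
Unset Printing Implicit Defensive.

Import Order.TTheory GRing.Theory Num.Theory.
Import numFieldNormedType.Exports.

Local Open Scope classical_set_scope.
Local Open Scope ring_scope.

Definition psdmx (R : realType) (n : nat) (M : 'M[R]_n) : Prop :=
  M \is symmetricmx /\ forall x : 'cV[R]_n, 0 <= (x^T *m M *m x) 0 0.

Definition pdmx (R : realType) (n : nat) (M : 'M[R]_n) : Prop :=
  M \is symmetricmx /\
  forall x : 'cV[R]_n, x != 0 -> 0 < (x^T *m M *m x) 0 0.

(* The principal square root of a positive semidefinite matrix, i.e. its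
   unique positive semidefinite square root; 0 by default if M has none. *)
Definition sqrtmx (R : realType) (n : nat) (M : 'M[R]_n) : 'M[R]_n :=
  xget 0 [set S : 'M[R]_n | psdmx S /\ S *m S = M].

(* Eigenvalues are the complex ones, hence the embedding of M into R[i]. *)
Definition stable_matrix (R : realType) (n : nat) (M : 'M[R]_n) : Prop :=
  forall z : R[i], eigenvalue (map_mx (real_complex R) M) z ->
    complex.Re z < 0.

(* x solves x' = A x + f on [0, T] in the sense of Caratheodory, so that f may
   be any integrable function (see admissible). *)
Definition trajectory (R : realType) (n : nat) (A : 'M[R]_n)
    (f : R -> 'cV[R]_n) (T : R) (x : R -> 'cV[R]_n) : Prop :=
  {within `[0, T], continuous x} /\
  forall t : R, 0 <= t <= T -> forall i : 'I_n,
    x t i 0 = x 0 i 0 +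
      \int[@lebesgue_measure R]_(s in `[0, t]) (A *m x s + f s) i 0.

Definition admissible (R : realType) (m : nat) (T : R)
    (u : R -> 'cV[R]_m) : Prop :=
  forall j : 'I_m,
    (@lebesgue_measure R).-integrable `[0, T] (fun s => (u s j 0)%:E).

Definition controllable (R : realType) (n m : nat)
    (A : 'M[R]_n) (B : 'M[R]_(n, m)) : Prop :=
  forall x0 x1 : 'cV[R]_n, exists T : R, 0 < T /\
    exists (u : R -> 'cV[R]_m) (x : R -> 'cV[R]_n),
      [/\ admissible T u, trajectory A (fun t => B *m u t) T x,
          x 0 = x0 & x T = x1].

(* The initial state is determined by the output y = C x on a finite horizon.
   By linearity it is enough to consider the unforced system. *)
Definition observable (R : realType) (n p : nat)
    (C : 'M[R]_(p, n)) (A : 'M[R]_n) : Prop :=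
  exists T : R, 0 < T /\
    forall x x' : R -> 'cV[R]_n,
      trajectory A (fun=> 0) T x -> trajectory A (fun=> 0) T x' ->
      (forall t : R, 0 <= t <= T -> C *m x t = C *m x' t) ->
      x 0 = x' 0.

Definition stabilizing_controllers (R : realType) (n m p : nat)
    (A : 'M[R]_n) (B : 'M[R]_(n, m)) (C : 'M[R]_(p, n)) :
    set 'M[R]_(m + n, p + n) :=
  [set K | exists (AK : 'M[R]_n) (BK : 'M[R]_(n, p)) (CK : 'M[R]_(m, n)),
    K = block_mx 0 CK BK AK /\
    stable_matrix (block_mx A (B *m CK) (BK *m C) AK)].

(* The library's topology on 'M[R]_(m, n) is the entrywise (product) one, which
   is the Euclidean topology. *)
Definition path_connected (R : realType) (X : topologicalType)
    (S : set X) : Prop :=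
  forall x y : X, S x -> S y ->
    exists f : R -> X,
      [/\ {within `[0, 1], continuous f}, f 0 = x, f 1 = y &
          forall t : R, 0 <= t <= 1 -> S (f t)].

(* Main.v *)
Require Import Defs.
From mathcomp Require Import all_boot all_order all_algebra.
From mathcomp Require Import all_classical all_reals all_analysis.
From mathcomp Require Import complex ring lra.
Import numFieldNormedType.Exports.

(** By Lyapunov's theorem the closed loop is stable iff it has a certificate
    P > 0. Write X, V for the upper blocks of P and Y, U for those of its
    inverse. In the variables (X, Y, F = CK V^T, H = U BK, M), where M is the
    lower left block of the congruence-transformed Lyapunov inequality, the
    certificate condition becomes the convex condition [lmi], and a controller
    is recovered from a solution by choosing invertible U and W = V^T with
    U W = 1 - Y X. Since A is stable, [lmi] has a solution with F = H = 0.
    Following the segment from the solution given by K to that one, with U kept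
    constant, joins K to a controller with BK = 0 and CK = 0, which stabilizes
    as soon as AK is stable; AK can then be moved along a segment to -1. Keeping
    U constant is what makes the two components of GL_n irrelevant here. *)

Set Implicit Arguments.
Unset Strict Implicit.
Unset Printing Implicit Defensive.
Import Order.TTheory GRing.Theory Num.Theory.
Local Open Scope classical_set_scope.
Local Open Scope ring_scope.

(** * Quadratic forms and matrices with positive definite symmetric part *)

Section QuadraticForms.
Variable R : realType.

Definition qf (n : nat) (M : 'M[R]_n) (x : 'cV[R]_n) : R := (x^T *m M *m x) 0 0.

(* No symmetry is required: this is definiteness of the symmetric part. *)
Definition posmx (n : nat) (M : 'M[R]_n) : Prop :=
  forall x : 'cV[R]_n, x != 0 -> 0 < qf M x.

Lemma qf0 n (M : 'M[R]_n) : qf M 0 = 0.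
Proof. by rewrite /qf mulmx0 mxE. Qed.

Lemma qfD n (M N : 'M[R]_n) x : qf (M + N) x = qf M x + qf N x.
Proof. by rewrite /qf mulmxDr mulmxDl mxE. Qed.

Lemma qfZ n a (M : 'M[R]_n) x : qf (a *: M) x = a * qf M x.
Proof. by rewrite /qf -scalemxAr -scalemxAl mxE. Qed.

Lemma qfN n (M : 'M[R]_n) x : qf (- M) x = - qf M x.
Proof. by rewrite -scaleN1r qfZ mulN1r. Qed.

Lemma qf_tr n (M : 'M[R]_n) x : qf M^T x = qf M x.
Proof.
rewrite /qf -[in RHS](trmxK (x^T *m M *m x)) [in RHS]mxE.
by rewrite !trmx_mul trmxK mulmxA.
Qed.

Lemma qf_cong m n (T : 'M[R]_(m, n)) (M : 'M[R]_m) x :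
  qf (T^T *m M *m T) x = qf M (T *m x).
Proof. by rewrite /qf trmx_mul !mulmxA. Qed.

Lemma qf_scale n (M : 'M[R]_n) a x : qf M (a *: x) = a ^+ 2 * qf M x.
Proof.
by rewrite /qf -scalemxAr linearZ/= -!scalemxAl !mxE mulrA expr2.
Qed.

Lemma qf_sum n (M : 'M[R]_n) x : qf M x = \sum_i \sum_j x i 0 * M i j * x j 0.
Proof.
rewrite /qf mxE exchange_big/=; apply: eq_bigr => j _.
by rewrite mxE mulr_suml; apply: eq_bigr => i _; rewrite mxE.
Qed.

Lemma qf_block m n (A : 'M[R]_m) B C (D : 'M[R]_n) x y :
  qf (block_mx A B C D) (col_mx x y) =
  qf A x + (x^T *m B *m y) 0 0 + (y^T *m C *m x) 0 0 + qf D y.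
Proof.
rewrite /qf tr_col_mx mul_row_block mul_row_col !mulmxDl !mxE; ring.
Qed.

Lemma posmx_cong n (T M : 'M[R]_n) :
  T \in unitmx -> posmx M -> posmx (T^T *m M *m T).
Proof.
move=> uT pM x x0; rewrite qf_cong; apply: pM.
apply: contra_neq x0 => /(congr1 (mulmx (invmx T))).
by rewrite mulKmx// mulmx0.
Qed.

Lemma posmxD n (M N : 'M[R]_n) : posmx M -> posmx N -> posmx (M + N).
Proof. by move=> pM pN x x0; rewrite qfD addr_gt0 ?pM ?pN. Qed.

Lemma posmx_conv n (M N : 'M[R]_n) (t : R) : 0 <= t <= 1 ->
  posmx M -> posmx N -> posmx ((1 - t) *: M + t *: N).
Proof.
move=> /andP[t0 t1] pM pN x x0; rewrite qfD !qfZ.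
have := pM x x0; have := pN x x0 => a b.
by have [->|t0'] := eqVneq t 0; [lra|nra].
Qed.

Lemma posmx_unit n (M : 'M[R]_n) : posmx M -> M \in unitmx.
Proof.
move=> pM; rewrite -unitmx_tr -row_free_unit -kermx_eq0; apply/rowV0P => v /sub_kermxP vM.
apply/eqP/negPn/negP => v0; have := pM v^T; rewrite trmx_eq0 => /(_ v0).
rewrite -qf_tr /qf trmxK vM mul0mx mxE ltxx//.
Qed.

Lemma posmx_ul m n (A : 'M[R]_m) B C (D : 'M[R]_n) :
  posmx (block_mx A B C D) -> posmx A.
Proof.
move=> p x x0; have := p (col_mx x 0); rewrite col_mx_eq0 (negPf x0) => /(_ isT).
by rewrite qf_block qf0 trmx0 !mul0mx mulmx0 mxE !addr0.
Qed.

Lemma posmx_dr m n (A : 'M[R]_m) B C (D : 'M[R]_n) :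
  posmx (block_mx A B C D) -> posmx D.
Proof.
move=> p x x0; have := p (col_mx 0 x); rewrite col_mx_eq0 (negPf x0) andbF => /(_ isT).
by rewrite qf_block qf0 trmx0 !mul0mx mulmx0 mxE !add0r.
Qed.

(** The two cross terms are opposite scalars and cancel, so the form splits as the sum of those of
    [A] and [D]. *)
Lemma posmx_block_skew m n (A : 'M[R]_m) B (D : 'M[R]_n) :
  posmx A -> posmx D -> posmx (block_mx A B (- B^T) D).
Proof.
move=> pA pD w; rewrite -[w]vsubmxK; set x := usubmx w; set y := dsubmx w.
rewrite qf_block col_mx_eq0 negb_and => xy.
have -> : (y^T *m - B^T *m x) 0 0 = - (x^T *m B *m y) 0 0.
  rewrite mulmxN mulNmx mxE -[in RHS](trmxK (x^T *m B *m y)) [in RHS]mxE.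
  by rewrite !trmx_mul trmxK mulmxA.
rewrite addrK.
have q0 k (T : 'M[R]_k) v : posmx T -> 0 <= qf T v.
  by move=> pT; have [->|/pT/ltW//] := eqVneq v 0; rewrite qf0.
by case/orP: xy => [/pA|/pD] h; [rewrite ltr_pwDl ?q0|rewrite ltr_wpDl ?q0].
Qed.

Lemma posmx_block_diag m n (A : 'M[R]_m) (D : 'M[R]_n) :
  posmx A -> posmx D -> posmx (block_mx A 0 0 D).
Proof. by move=> pA pD; have := posmx_block_skew 0 pA pD; rewrite trmx0 oppr0. Qed.

(** The inverse is the congruence of [M^T] by [invmx M], and [M^T] has the same quadratic form as
    [M]. *)
Lemma posmx_inv n (M : 'M[R]_n) : posmx M -> posmx (invmx M).
Proof.
move=> pM; have uM := posmx_unit pM.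
have -> : invmx M = (invmx M)^T *m M^T *m invmx M.
  by rewrite -trmx_mul mulmxV// trmx1 mul1mx.
by apply: posmx_cong; rewrite ?unitmx_inv// => x x0; rewrite qf_tr; apply: pM.
Qed.

Lemma cvg_bigsum T (F : set_system T) (FF : Filter F) (I : Type) (r : seq I)
    (f : I -> T -> R) (l : I -> R) :
  (forall i, f i x @[x --> F] --> l i) ->
  \sum_(i <- r) f i x @[x --> F] --> \sum_(i <- r) l i.
Proof. by move=> fl; apply: cvg_big => // x; exact: add_continuous. Qed.

Lemma continuous_qf n (M : 'M[R]_n) :
  continuous (fun x : 'rV[R]_n => qf M x^T : R).
Proof.
have -> : (fun x : 'rV[R]_n => qf M x^T : R) =
    (fun x => \sum_i \sum_j x 0 i * M i j * x 0 j).
  apply/funext => x; rewrite qf_sum.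
  by apply: eq_bigr => i _; apply: eq_bigr => j _; rewrite !mxE.
move=> x.
apply: (@cvg_bigsum _ (nbhs x)) => i; apply: (@cvg_bigsum _ (nbhs x)) => j.
apply: cvgM; last exact: coord_continuous.
by apply: cvgM; [exact: coord_continuous|exact: cvg_cst].
Qed.

(** The constant is the minimum of the form on the compact unit sphere, and homogeneity of degree 2
    extends the bound to all vectors. Row vectors appear because the norm, compactness and the
    extreme value theorem are used for them. *)
Lemma posmx_coercive n (M : 'M[R]_n) : posmx M ->
  exists2 c : R, 0 < c & forall x : 'cV[R]_n, c * `|x^T| ^+ 2 <= qf M x.
Proof.
move=> pM; case: (pselect (exists v : 'rV[R]_n, v != 0)) => [[v v0]|h]; last first.
  exists 1 => // x; have -> : x = 0.
    apply/eqP/negPn/negP => x0; apply: h; exists x^T; by rewrite trmx_eq0.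
  by rewrite trmx0 normr0 qf0 expr0n mulr0.
pose A := [set x : 'rV[R]_n | `|x| = 1].
have cA : compact A.
  apply: bounded_closed_compact.
    exists 1; split; first exact: num_real.
    by move=> M1 M1lt x /= ->; exact: ltW.
  have -> : A = (fun x : 'rV[R]_n => `|x|) @^-1` [set 1] by [].
  apply: closed_comp; last exact: closed_eq.
  by move=> x _; exact: norm_continuous.
have A0 : A !=set0.
  exists (`|v|^-1 *: v); rewrite /A/= normrZ normfV normr_id mulVf//.
  by rewrite normr_eq0.
have [|c] := EVT_min_rV (f := fun x : 'rV[R]_n => qf M x^T) A0 cA.
  by apply: continuous_subspaceT; exact: continuous_qf.
rewrite inE /A/= => c1 cmin; exists (qf M c^T).
  apply: pM; rewrite trmx_eq0 -normr_eq0 c1; exact: oner_neq0.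
move=> x; have [->|x0] := eqVneq x 0.
  by rewrite trmx0 normr0 qf0 expr0n mulr0.
have nx : `|x^T| != 0 by rewrite normr_eq0 trmx_eq0.
have := cmin (`|x^T|^-1 *: x^T).
rewrite inE /A/= normrZ normfV normr_id mulVf// => /(_ erefl).
rewrite linearZ/= trmxK qf_scale => h.
have p : 0 < `|x^T| ^+ 2 by rewrite exprn_gt0// lt_def nx normr_ge0.
rewrite -ler_pdivlMr// [leRHS]mulrC -exprVn//.
Qed.

Lemma qf_bound n (M : 'M[R]_n) :
  exists2 c : R, 0 < c & forall x : 'cV[R]_n, `|qf M x| <= c * `|x^T| ^+ 2.
Proof.
exists (1 + \sum_i \sum_j `|M i j|).
  by rewrite ltr_pwDl// sumr_ge0// => i _; rewrite sumr_ge0.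
move=> x; rewrite qf_sum mulrDl mul1r.
have e i : `|x i 0| <= `|x^T|.
  rewrite [leRHS]/Num.norm/= mx_normrE; apply: le_trans (le_bigmax _ _ (0, i)) => /=.
  by rewrite mxE.
apply: (@le_trans _ _ ((\sum_i \sum_j `|M i j|) * `|x^T| ^+ 2)); last first.
  by rewrite lerDr exprn_ge0.
rewrite mulr_suml; apply: le_trans (ler_norm_sum _ _ _) _.
apply: ler_sum => i _; rewrite mulr_suml; apply: le_trans (ler_norm_sum _ _ _) _.
apply: ler_sum => j _; rewrite !normrM mulrAC [leRHS]mulrC expr2.
by apply: ler_wpM2r => //; apply: ler_pM.
Qed.

(** If [qf M] is at least [c] times the squared norm and [qf N] at most [b] times it in absolute
    value, any [s] below [c / b] in absolute value keeps the sum positive. *)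
Lemma posmx_open n (M N : 'M[R]_n) : posmx M ->
  exists2 d : R, 0 < d & forall s, `|s| < d -> posmx (M + s *: N).
Proof.
move=> /posmx_coercive[c c0 hc]; have [b b0 hb] := qf_bound N.
exists (c / b); first by rewrite divr_gt0.
move=> s sd x x0; rewrite qfD qfZ.
have p : 0 < `|x^T| ^+ 2 by rewrite exprn_gt0// normr_gt0 trmx_eq0.
have := hc x; have := hb x; rewrite ler_norml => /andP[h1 h2] h3.
have h4 : `|s * qf N x| < c * `|x^T| ^+ 2.
  rewrite normrM; apply: (@le_lt_trans _ _ (`|s| * (b * `|x^T| ^+ 2))).
    by apply: ler_wpM2l => //; exact: hb.
  by rewrite mulrA ltr_pM2r// -ltr_pdivlMr.
move: h4; rewrite ltr_norml => /andP[h4 _]; lra.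
Qed.

End QuadraticForms.

Lemma invmx_mul (F : fieldType) n (M N : 'M[F]_n) : M \in unitmx -> N \in unitmx ->
  invmx (M *m N) = invmx N *m invmx M.
Proof.
move=> uM uN; have uMN : M *m N \in unitmx by rewrite unitmx_mul uM.
rewrite -[RHS]mulmx1 -(mulmxV uMN) !mulmxA -[_ *m _ *m M]mulmxA mulVmx//.
by rewrite mulmx1 mulVmx// mul1mx.
Qed.

(** * Lyapunov's theorem: stability is equivalent to the existence of a quadratic certificate *)

Section Lyapunov.
Variable R : realType.
Local Notation cplx := (real_complex R).
Local Notation normc := ComplexField.Normc.normc.

Lemma ReD (x y : R[i]) : complex.Re (x + y) = complex.Re x + complex.Re y.
Proof. by case: x y => [? ?] [? ?]. Qed.

Lemma ImD (x y : R[i]) : complex.Im (x + y) = complex.Im x + complex.Im y.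
Proof. by case: x y => [? ?] [? ?]. Qed.

Lemma Re_sum I (r : seq I) (f : I -> R[i]) :
  complex.Re (\sum_(i <- r) f i) = \sum_(i <- r) complex.Re (f i).
Proof. exact: (big_morph _ ReD). Qed.

Lemma Im_sum I (r : seq I) (f : I -> R[i]) :
  complex.Im (\sum_(i <- r) f i) = \sum_(i <- r) complex.Im (f i).
Proof. exact: (big_morph _ ImD). Qed.

Lemma ReMr (x : R[i]) (a : R) : complex.Re (x * cplx a) = complex.Re x * a.
Proof. by case: x => ? ? /=; rewrite mulr0 subr0. Qed.

Lemma ReMl (a : R) (x : R[i]) : complex.Re (cplx a * x) = a * complex.Re x.
Proof. by rewrite mulrC ReMr mulrC. Qed.

Lemma ImMr (x : R[i]) (a : R) : complex.Im (x * cplx a) = complex.Im x * a.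
Proof. by case: x => ? ? /=; rewrite mulr0 add0r. Qed.

(** For a left eigenvector [v = x + i y] of eigenvalue [z], the forms of [M *m P] at [x] and [y] add
    up to [Re z] times those of [P]: the terms in [Im z] cancel because [P] is symmetric. The signs
    of both sides force [Re z < 0]. *)
Lemma lyapunov_stable n (M P : 'M[R]_n) :
  P^T = P -> posmx P -> posmx (- (M *m P)) -> stable_matrix M.
Proof.
move=> sP pP nMP z /eigenvalueP[v vM v0].
pose x := (map_mx (@complex.Re R) v)^T; pose y := (map_mx (@complex.Im R) v)^T.
have Mx : M^T *m x = complex.Re z *: x - complex.Im z *: y.
  apply/matrixP => i j; rewrite ord1 !mxE.
  transitivity (complex.Re ((v *m map_mx cplx M) 0 i)).
    rewrite mxE Re_sum; apply: eq_bigr => k _.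
    by rewrite !mxE ReMr mulrC.
  by rewrite vM mxE; case: (z) (v 0 i) => [? ?] [? ?].
have My : M^T *m y = complex.Im z *: x + complex.Re z *: y.
  apply/matrixP => i j; rewrite ord1 !mxE.
  transitivity (complex.Im ((v *m map_mx cplx M) 0 i)).
    rewrite mxE Im_sum; apply: eq_bigr => k _.
    by rewrite !mxE ImMr mulrC.
  by rewrite vM mxE; case: (z) (v 0 i) => [? ?] [? ?] /=; rewrite addrC.
have xy0 : x != 0 \/ y != 0.
  case: (eqVneq x 0) => [x0|]; [right|by left].
  apply: contra_neq v0 => y0; apply/matrixP => i j; rewrite ord1 mxE.
  move/matrixP: x0 => /(_ j 0); move/matrixP: y0 => /(_ j 0); rewrite !mxE.
  by case: (v 0 j) => a b /= -> ->.
clearbody x y.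
have qM w : qf (M *m P) w = ((M^T *m w)^T *m P *m w) 0 0.
  by rewrite /qf trmx_mul trmxK !mulmxA.
have e : qf (M *m P) x + qf (M *m P) y = complex.Re z * (qf P x + qf P y).
  rewrite !qM Mx My [(_ - _)^T]linearB [(_ + _)^T]linearD/= !linearZ/= scalerN.
  rewrite !mulmxBl !mulmxDl -!scalemxAl.
  have mD (U V : 'M[R]_1) a b : (a *: U + b *: V) 0 0 = a * U 0 0 + b * V 0 0.
    by rewrite !mxE.
  rewrite -scaleNr !mD.
  rewrite /qf; have -> : (y^T *m P *m x) 0 0 = (x^T *m P *m y) 0 0.
    rewrite -[in LHS](trmxK (y^T *m P *m x)) [in LHS]mxE.
    by rewrite !trmx_mul trmxK sP mulmxA.
  ring.
have p0 w : 0 <= qf P w.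
  by have [->|/pP/ltW//] := eqVneq w 0; rewrite qf0.
have m0 w : qf (M *m P) w <= 0.
  have [->|/nMP] := eqVneq w 0; first by rewrite qf0.
  by rewrite qfN oppr_gt0 => /ltW.
have := p0 x; have := p0 y; have := m0 x; have := m0 y.
by case: xy0 => [w0|w0]; have := pP _ w0; have := nMP _ w0; rewrite qfN; nra.
Qed.

(** The certificate is [P = T1 *m invmx T2]; both [P] and [M *m P] are congruent, by [invmx T2], to
    the matrices in the hypotheses. *)
Lemma factor_stable n (M T1 T2 : 'M[R]_n) : T2 \in unitmx ->
  (T2^T *m T1)^T = T2^T *m T1 -> posmx (T2^T *m T1) ->
  posmx (- (T2^T *m M *m T1)) -> stable_matrix M.
Proof.
move=> u2 sS pS nS.
have u2t : invmx T2 \in unitmx by rewrite unitmx_inv.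
have t2 : (invmx T2)^T *m T2^T = 1%:M by rewrite -trmx_mul mulmxV// trmx1.
have e : T1 *m invmx T2 = (invmx T2)^T *m (T2^T *m T1) *m invmx T2.
  by rewrite mulmxA t2 mul1mx.
apply: (@lyapunov_stable _ _ (T1 *m invmx T2)).
- by rewrite e !trmx_mul -trmx_mul sS !trmxK !mulmxA.
- by rewrite e; exact: posmx_cong.
- have -> : M *m (T1 *m invmx T2) = (invmx T2)^T *m (T2^T *m M *m T1) *m invmx T2.
    by rewrite !mulmxA t2 mul1mx.
  by rewrite -mulNmx -mulmxN; exact: posmx_cong.
Qed.

(** The conjugate transpose. *)
Definition ctr m n (M : 'M[R[i]]_(m, n)) : 'M[R[i]]_(n, m) :=
  map_mx (fun z => conjc z) M^T.

Lemma ctrM m n p (M : 'M[R[i]]_(m, n)) (N : 'M[R[i]]_(n, p)) :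
  ctr (M *m N) = ctr N *m ctr M.
Proof. by rewrite /ctr trmx_mul map_mxM. Qed.

Lemma ctrK m n (M : 'M[R[i]]_(m, n)) : ctr (ctr M) = M.
Proof. by apply/matrixP => i j; rewrite !mxE conjcK. Qed.

Lemma normc_ge0 (z : R[i]) : 0 <= normc z.
Proof. by case: z => a b; exact: sqrtr_ge0. Qed.

Lemma Re_le_normc (z : R[i]) : complex.Re z <= normc z.
Proof.
case: z => a b /=; apply: le_trans (ler_norm _) _.
by rewrite -sqrtr_sqr ler_wsqrtr// lerDl sqr_ge0.
Qed.

Lemma normcJ (z : R[i]) : normc (conjc z) = normc z.
Proof. by case: z => a b /=; rewrite sqrrN. Qed.

Lemma Re_mulJ (z w : R[i]) :
  complex.Re (z * w * conjc z) = complex.Re w * normc z ^+ 2.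
Proof.
case: z w => [a b] [c d] /=; rewrite sqr_sqrtr ?addr_ge0 ?sqr_ge0//; ring.
Qed.

(** With [S] the squared norm of [y], the diagonal contributes at most [- a * S] and, by the
    inequality of arithmetic and geometric means, the other entries at most [n%:R * e * S]. *)
Lemma Re_diag_dominant n (Q : 'M[R[i]]_n) (a e : R) (y : 'rV[R[i]]_n) :
  0 <= e -> n%:R * e < a ->
  (forall i, complex.Re (Q i i) <= - a) ->
  (forall i j, i != j -> normc (Q i j) <= e) -> y != 0 ->
  complex.Re ((y *m Q *m ctr y) 0 0) < 0.
Proof.
move=> e0 ea dQ oQ y0; pose r i := normc (y 0 i).
pose S := \sum_i r i ^+ 2.
have S0 : 0 < S.
  rewrite lt_def sumr_ge0 => [|i _]; last exact: sqr_ge0.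
  rewrite andbT; apply: contra_neq y0 => /eqP.
  rewrite psumr_eq0 => [/allP h|i _]; last exact: sqr_ge0.
  apply/matrixP => i j; rewrite ord1 mxE; apply: ComplexField.Normc.eq0_normc.
  by have := h j (mem_index_enum j); rewrite /= sqrf_eq0 => /eqP.
apply: (@le_lt_trans _ _ (- (a * S) + n%:R * e * S)); last by nra.
have -> : complex.Re ((y *m Q *m ctr y) 0 0) =
    \sum_i \sum_j complex.Re (y 0 i * Q i j * conjc (y 0 j)).
  rewrite mxE Re_sum exchange_big/=; apply: eq_bigr => j _.
  by rewrite mxE mulr_suml Re_sum; apply: eq_bigr => i _; rewrite !mxE.
(* The bound is spread over the pairs [(i, j)] so that the two double sums can be compared term by
   term. *)
have -> : - (a * S) + n%:R * e * S = \sum_i \sum_j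
    ((if i == j then - (a * r i ^+ 2) else 0) + e / 2 * (r i ^+ 2 + r j ^+ 2)).
  transitivity (\sum_i (- (a * r i ^+ 2) + e / 2 * (n%:R * r i ^+ 2 + S))); last first.
    apply: eq_bigr => i _; rewrite big_split/=; congr (_ + _).
      by rewrite -big_mkcond/= (big_pred1 i)// => j; rewrite /= eq_sym.
    by rewrite -mulr_sumr big_split/= sumr_const card_ord mulr_natl.
  rewrite big_split/= sumrN -mulr_sumr; congr (_ + _).
  rewrite -mulr_sumr big_split/= -mulr_sumr sumr_const card_ord -mulr_natl -/S.
  by field.
apply: ler_sum => i _; apply: ler_sum => j _.
have ri k : 0 <= r k by exact: normc_ge0.
case: eqVneq => [<-|ij].
  rewrite Re_mulJ -/(r i); have := dQ i; have := sqr_ge0 (r i).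
  set u := r i ^+ 2; set v := complex.Re _ => h1 h2; nra.
apply: le_trans (Re_le_normc _) _.
rewrite !ComplexField.Normc.normcM normcJ -/(r i) -/(r j) add0r.
have := oQ _ _ ij; have := normc_ge0 (Q i j); have := ri i; have := ri j.
set u := r i; set v := r j; set w := normc _ => h1 h2 h3 h4.
have h5 : u * v <= (u ^+ 2 + v ^+ 2) / 2.
  by have := sqr_ge0 (u - v); rewrite sqrrB; lra.
have h6 : w * (u * v) <= e * (u * v) by apply: ler_wpM2r => //; exact: mulr_ge0.
have h7 : e * (u * v) <= e * ((u ^+ 2 + v ^+ 2) / 2) by exact: ler_wpM2l.
lra.
Qed.

(** The certificate is the real part of the Hermitian matrix [H]. For real [x] and
    [w = x^T *m invmx G], its form at [x] is the squared norm of [w], and that of [M *m P] is the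
    real part of the form of [G *m M *m invmx G] at [w]. *)
Lemma stable_lyapunov_of_complex n (M : 'M[R]_n) (G : 'M[R[i]]_n) :
  G \in unitmx ->
  (forall y : 'rV_n, y != 0 ->
     complex.Re ((y *m (G *m map_mx cplx M *m invmx G) *m ctr y) 0 0) < 0) ->
  exists P : 'M[R]_n, [/\ P^T = P, posmx P & posmx (- (M *m P))].
Proof.
move=> uG neg; pose H := invmx G *m ctr (invmx G).
pose ReM (N : 'M[R[i]]_n) := map_mx (@complex.Re R) N.
have ReMM (N : 'M[R[i]]_n) : ReM (map_mx cplx M *m N) = M *m ReM N.
  apply/matrixP => i j; rewrite !mxE Re_sum; apply: eq_bigr => k _.
  by rewrite !mxE ReMl.
have qRe (N : 'M[R[i]]_n) (x : 'cV[R]_n) : qf (ReM N) x =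
    complex.Re ((map_mx cplx x^T *m N *m ctr (map_mx cplx x^T)) 0 0).
  rewrite qf_sum mxE Re_sum exchange_big/=; apply: eq_bigr => j _.
  rewrite mxE mulr_suml Re_sum; apply: eq_bigr => i _.
  by rewrite !mxE conjc_real ReMr ReMl.
have x0 (x : 'cV[R]_n) : x != 0 -> map_mx cplx x^T *m invmx G != 0.
  apply: contra_neq => /(congr1 (mulmx^~ G)); rewrite mulmxKV// mul0mx => h.
  apply/matrixP => i j; rewrite ord1 mxE.
  by move/matrixP: h => /(_ 0 i); rewrite !mxE => -[].
exists (ReM H); split.
- apply/matrixP => i j.
  have sH : ctr H = H by rewrite /H ctrM ctrK.
  rewrite [RHS]mxE -[in RHS]sH !mxE.
  by case: (\sum_(_ < n) _).
- move=> x /x0; set w := _ *m _ => w0.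
  have -> : qf (ReM H) x = complex.Re ((w *m ctr w) 0 0).
    by rewrite qRe /w /H ctrM !mulmxA.
  rewrite -[X in 0 < X]opprK oppr_gt0.
  (* Positivity of the squared norm of [w] is the diagonally dominant case of the matrix -1. *)
  have := @Re_diag_dominant n (- 1%:M) 1 0 w (lexx _).
  rewrite mulr0 => /(_ ltr01).
  have -> : complex.Re ((w *m - 1%:M *m ctr w) 0 0) = - complex.Re ((w *m ctr w) 0 0).
    by rewrite mulmxN mulmx1 mulNmx mxE; case: (_ 0 0).
  apply=> //.
  + by move=> i; rewrite !mxE eqxx.
  + move=> i j ij; rewrite !mxE (negPf ij) mulr0n oppr0.
    by rewrite ComplexField.Normc.normc0.
- move=> x /x0; set w := _ *m _ => w0; rewrite qfN oppr_gt0.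
  rewrite -ReMM qRe; have := neg _ w0; congr (complex.Re (_ 0 0) < 0).
  by rewrite /w /H ctrM !mulmxA mulmxKV.
Qed.

Lemma pos_lower_bound n (f : 'I_n -> R) : (forall i, 0 < f i) ->
  exists2 a : R, 0 < a & forall i, a <= f i.
Proof.
move=> f0; exists (\big[Num.min/1]_i f i).
  by apply: lt_bigmin => // i _.
by move=> i; exact: bigmin_le.
Qed.

(** Schur's theorem makes [M] lower triangular over the complex numbers, with the eigenvalues on the
    diagonal; a diagonal scaling then makes the off-diagonal entries small enough for
    [Re_diag_dominant]. *)
Lemma stable_lyapunov n (M : 'M[R]_n) : stable_matrix M ->
  exists P : 'M[R]_n, [/\ P^T = P, posmx P & posmx (- (M *m P))].
Proof.
case: n M => [|n] M sM.
  exists 0; split; first by rewrite trmx0.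
  - by move=> x; rewrite (flatmx0 x) eqxx.
  - by move=> x; rewrite (flatmx0 x) eqxx.
set MC := map_mx cplx M.
have [T /spectral.unitarymx_unit uT] := spectral.Schur MC (ltn0Sn n).
set N := conjmx T MC => /is_trig_mxP tN.
have NE : N = T *m MC *m invmx T by rewrite /N conjumx.
have dN i : 0 < - complex.Re (N i i).
  rewrite oppr_gt0; apply: sM; have : eigenvalue N (N i i).
    rewrite eigenvalue_root_char char_poly_trig; last exact/is_trig_mxP.
    apply/rootP; rewrite horner_prod (bigD1 i)//= !hornerE subrr mul0r//.
  move=> /eigenvalueP[v vN v0]; apply/eigenvalueP; exists (v *m T).
    by move: vN; rewrite NE => /(congr1 (mulmx^~ T)); rewrite !mulmxA mulmxKV// scalemxAl.
  apply: contra_neq v0 => /(congr1 (mulmx^~ (invmx T))).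
  by rewrite mulmxK// mul0mx.
have [a a0 ha] := pos_lower_bound dN.
pose c := \sum_i \sum_j normc (N i j).
have c0 : 0 <= c.
  by rewrite sumr_ge0// => i _; rewrite sumr_ge0// => j _; exact: normc_ge0.
have hc i j : normc (N i j) <= c.
  rewrite /c (bigD1 i)//= (bigD1 j)//= -!addrA lerDl addr_ge0//.
    by rewrite sumr_ge0// => ? _; exact: normc_ge0.
  by rewrite sumr_ge0// => ? _; rewrite sumr_ge0// => ? _; exact: normc_ge0.
(* The size is [n.+1], so dividing by [n.+2] gives the strict inequality [n.+1%:R * e < a]. The
   choice of [d] below ensures both [d <= 1] and [d * c <= e]. *)
pose e := a / n.+2%:R.
have e0 : 0 < e by rewrite divr_gt0.
have ea : n.+1%:R * e < a.
  by rewrite /e mulrCA gtr_pMr// ltr_pdivrMr// mul1r ltr_nat.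
pose d := e / (e + c).
have ec0 : 0 < e + c by rewrite ltr_pwDl.
have d0 : 0 < d by rewrite divr_gt0.
have d1 : d <= 1 by rewrite ler_pdivrMr// mul1r lerDl.
have dc : d * c <= e by rewrite /d mulrAC ler_pdivrMr// ler_pM2l// lerDr ltW.
(* Conjugating a lower triangular matrix by diag(1, d, d^2, ...) multiplies the
   entry (i, j) by d^(i - j), so the off-diagonal part is at most d * c. *)
pose D := diag_mx (\row_(i < n.+1) cplx (d ^+ i)).
pose D' := diag_mx (\row_(i < n.+1) cplx (d ^- i)).
have DD' : D *m D' = 1%:M.
  apply/matrixP => i j; rewrite mul_diag_mx !mxE.
  case: eqVneq => [->|_]; last by rewrite mulr0n mulr0.
  by rewrite !mulr1n -rmorphM/= divff// expf_neq0// gt_eqF.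
have [uD uD'] := mulmx1_unit DD'.
have iD : invmx D = D' by rewrite -[LHS]mulmx1 -DD' mulKmx.
apply: (@stable_lyapunov_of_complex _ _ (D *m T)); first by rewrite unitmx_mul uD.
move=> y y0.
have -> : D *m T *m map_mx cplx M *m invmx (D *m T) = D *m N *m D'.
  by rewrite NE invmx_mul// iD !mulmxA.
have E i j : (D *m N *m D') i j = cplx (d ^+ i / d ^+ j) * N i j.
  rewrite mul_mx_diag mul_diag_mx !mxE mulrAC -rmorphM//.
apply: (@Re_diag_dominant _ _ a e) => //; first exact: ltW.
- move=> i; rewrite E divff ?expf_neq0 ?gt_eqF//.
  by rewrite rmorph1 mul1r lerNr.
- move=> i j ij; rewrite E ComplexField.Normc.normcM.
  case: (ltngtP i j) => [lij|lji|/val_inj eij].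
  + by rewrite tN// ComplexField.Normc.normc0 mulr0 ltW.
  + have -> : normc (cplx (d ^+ i / d ^+ j)) = d ^+ (i - j).
      rewrite /= expr0n addr0 sqrtr_sqr ger0_norm.
        by rewrite expfB.
      by rewrite divr_ge0// exprn_ge0// ltW.
    apply: le_trans dc; apply: ler_pM => //; first by rewrite exprn_ge0// ltW.
      exact: normc_ge0.
    rewrite -[X in _ <= X]expr1; apply: ler_wiXn2l => //; first exact: ltW.
    by rewrite subn_gt0.
  + by rewrite eij eqxx in ij.
Qed.

End Lyapunov.

Lemma subr3 (V : zmodType) (a b c d : V) : d - a - b - c = d - (a + b + c).
Proof. by rewrite !opprD !addrA. Qed.

Lemma addr_subr3 (V : zmodType) (a b c d : V) : a + b + c + (d - a - b - c) = d.
Proof. by rewrite subr3 addrC subrK. Qed.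

(** * The convex matrix inequality and its correspondence with stabilizing controllers *)

Section LMI.
Variable R : realType.

(** A nonzero [q] has fewer than [size q] roots, so it cannot vanish at [size q] distinct points of
    the interval. The points are [d / k.+2%:R], since [k.+1] would include [d] itself. *)
Lemma exists_nonroot (q : {poly R}) (d : R) : q != 0 -> 0 < d ->
  exists2 s, 0 < s < d & ~~ root q s.
Proof.
move=> q0 d0; apply/not_exists2P => h.
pose r := [seq d / k.+2%:R | k <- iota 0 (size q)].
have : (size r < size q)%N.
  apply: max_poly_roots => //.
    apply/allP => _ /mapP[k _ ->].
    have [|/negP] := h (d / k.+2%:R); last by rewrite negbK.
    case; rewrite divr_gt0//= ltr_pdivrMr// ltr_pMr// ltr1n//.
  rewrite map_inj_uniq ?iota_uniq// => j k /(mulfI (lt0r_neq0 d0)) /invr_inj /eqP.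
  by rewrite eqr_nat eqSS => /eqP[].
by rewrite size_map size_iota ltnn.
Qed.

Lemma tr_block_sym n (X Z V V' : 'M[R]_n) :
  (block_mx X V V' Z)^T = block_mx X V V' Z -> [/\ X^T = X, V' = V^T & Z^T = Z].
Proof. by rewrite tr_block_mx => /eq_block_mx[-> _ <- ->]. Qed.

(** Column elimination of [X] turns the invertible block matrix into one whose determinant is, up to
    sign, that of [1%:M - Y *m X]. *)
Lemma subYX_unit n (X Y : 'M[R]_n) :
  posmx (block_mx X 1%:M 1%:M Y) -> 1%:M - Y *m X \in unitmx.
Proof.
move=> /posmx_unit; rewrite unitmxE => u.
suff : \det (block_mx X 1%:M 1%:M Y *m block_mx 1%:M 0 (- X) 1%:M) \is a GRing.unit.
  rewrite mulmx_block !(mulmx1, mul1mx, mulmx0, add0r) subrr mulmxN.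
  have -> : block_mx 0 1%:M (1%:M - Y *m X) Y =
      block_mx 1%:M 0 Y (1%:M - Y *m X) *m block_mx 0 1%:M 1%:M 0.
    by rewrite mulmx_block !(mulmx1, mul1mx, mulmx0, mul0mx, addr0, add0r).
  by rewrite det_mulmx det_lblock det1 mul1r unitrM unitmxE => /andP[].
by rewrite det_mulmx det_lblock !det1 !mulr1.
Qed.

Variables (n m p : nat) (A : 'M[R]_n) (B : 'M[R]_(n, m)) (C : 'M[R]_(p, n)).

(** Both block matrices are affine in the five unknowns jointly: [M] stands for all the products of
    unknowns. The first positivity condition says that [X] and [Y - invmx X] are positive
    definite. *)
Definition lmi (X Y : 'M[R]_n) (F : 'M[R]_(m, n)) (H : 'M[R]_(n, p)) (M : 'M[R]_n) :=
  [/\ X^T = X, Y^T = Y, posmx (block_mx X 1%:M 1%:M Y) &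
      posmx (- block_mx (A *m X + B *m F) A M (Y *m A + H *m C))].

Lemma lmi_conv X0 Y0 F0 H0 M0 X1 Y1 F1 H1 M1 t : 0 <= t <= 1 ->
  lmi X0 Y0 F0 H0 M0 -> lmi X1 Y1 F1 H1 M1 ->
  lmi ((1 - t) *: X0 + t *: X1) ((1 - t) *: Y0 + t *: Y1)
      ((1 - t) *: F0 + t *: F1) ((1 - t) *: H0 + t *: H1)
      ((1 - t) *: M0 + t *: M1).
Proof.
move=> t01 [sX0 sY0 p0 n0] [sX1 sY1 p1 n1]; split.
- by rewrite linearD/= !linearZ/= sX0 sX1.
- by rewrite linearD/= !linearZ/= sY0 sY1.
- have := posmx_conv t01 p0 p1; rewrite !scale_block_mx add_block_mx.
  by rewrite -!scalerDl subrK scale1r.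
- have := posmx_conv t01 n0 n1; rewrite !scalerN -opprD !scale_block_mx add_block_mx.
  rewrite -[(1 - t) *: A + t *: A]scalerDl subrK scale1r.
  set a := 1 - t.
  have -> : a *: (A *m X0 + B *m F0) + t *: (A *m X1 + B *m F1) =
      A *m (a *: X0 + t *: X1) + B *m (a *: F0 + t *: F1).
    by rewrite !mulmxDr -!scalemxAr !scalerDr addrACA.
  have -> // : a *: (Y0 *m A + H0 *m C) + t *: (Y1 *m A + H1 *m C) =
      (a *: Y0 + t *: Y1) *m A + (a *: H0 + t *: H1) *m C.
    by rewrite !mulmxDl -!scalemxAl !scalerDr addrACA.
Qed.

(** The linearizing change of variables: with [F = Ck *m W] and [H = U *m Bk], every nonlinear term
    falls into the lower left block, which is renamed [M]. *)
Lemma closed_loop_congruence (X Y U W Ak : 'M[R]_n)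
    (Ck : 'M[R]_(m, n)) (Bk : 'M[R]_(n, p)) :
  Y^T = Y ->
  (block_mx 1%:M Y 0 U^T)^T *m block_mx A (B *m Ck) (Bk *m C) Ak
    *m block_mx X 1%:M W 0 =
  block_mx (A *m X + B *m (Ck *m W)) A
    (Y *m A *m X + U *m Bk *m C *m X + Y *m B *m (Ck *m W) + U *m Ak *m W)
    (Y *m A + (U *m Bk) *m C).
Proof.
move=> sY; rewrite tr_block_mx trmx0 trmx1 trmxK sY !mulmx_block.
rewrite !(mul1mx, mulmx1, mul0mx, mulmx0, addr0) !mulmxDl !mulmxA.
by rewrite addrA.
Qed.

(** [Ak] is obtained by solving the lower left block of [closed_loop_congruence] for it;
    [factor_stable] then applies, the product of the two factors being the block matrix of [X],
    [1%:M], [1%:M], [Y]. *)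
Lemma lmi_stable X Y F H M U W :
  lmi X Y F H M -> U \in unitmx -> U *m W = 1%:M - Y *m X ->
  stable_matrix (block_mx A (B *m (F *m invmx W)) (invmx U *m H *m C)
    (invmx U *m (M - Y *m A *m X - H *m C *m X - Y *m B *m F) *m invmx W)).
Proof.
move=> [sX sY pS nS] uU UW.
have uW : W \in unitmx.
  by have := subYX_unit pS; rewrite -UW unitmx_mul => /andP[].
have S : (block_mx 1%:M Y 0 U^T)^T *m block_mx X 1%:M W 0 =
    block_mx X 1%:M 1%:M Y.
  rewrite tr_block_mx trmx0 trmx1 trmxK sY mulmx_block.
  rewrite !(mul1mx, mulmx1, mul0mx, mulmx0, addr0) UW.
  by rewrite addrC subrK.
apply: (@factor_stable _ _ _ (block_mx X 1%:M W 0) (block_mx 1%:M Y 0 U^T)).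
- by rewrite unitmxE det_ublock det1 mul1r det_tr -unitmxE.
- by rewrite S tr_block_mx sX sY trmx1.
- by rewrite S.
rewrite closed_loop_congruence// !mulmxKV// !mulKVmx//.
rewrite [U *m (_ *m _ *m _)]mulmxA mulKVmx// mulmxKV//.
by rewrite addr_subr3.
Qed.

(** [X], [V] and [Y], [U] are the upper blocks of a certificate and of its inverse, and [W = V^T].
    The formulas for the controller match those of [lmi_stable], so that the given controller is the
    start of the path built later. *)
Lemma stable_lmi Ak Ck Bk :
  stable_matrix (block_mx A (B *m Ck) (Bk *m C) Ak) ->
  exists X Y F H M U W, [/\ lmi X Y F H M, U \in unitmx,
    U *m W = 1%:M - Y *m X & [/\ Ck = F *m invmx W, Bk = invmx U *m H &
    Ak = invmx U *m (M - Y *m A *m X - H *m C *m X - Y *m B *m F) *m invmx W]].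
Proof.
move=> /stable_lyapunov[P0 [sP0 pP0 nP0]]; set K := block_mx _ _ _ _ in nP0 *.
(* [P0] is perturbed so that its off-diagonal block, hence [U], is invertible. *)
pose N : 'M[R]_(n + n) := block_mx 0 1%:M 1%:M 0.
have [d1 d10 h1] := posmx_open N pP0.
have [d2 d20 h2] := posmx_open (- (K *m N)) nP0.
(* [s] is small enough for both definiteness conditions and is not an eigenvalue of [- ursubmx P0],
   so adding [s] to the off-diagonal block makes it invertible. *)
have [||s /andP[s0 sd] rs] :=
  exists_nonroot (q := char_poly (- ursubmx P0)) (d := Num.min d1 d2).
- by rewrite monic_neq0// char_poly_monic.
- by rewrite lt_min d10.
move: sd; rewrite lt_min => /andP[sd1 sd2].
pose P := P0 + s *: N.
have sP : P^T = P.
  by rewrite /P linearD linearZ/= sP0 /N tr_block_mx !trmx0 trmx1.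
have pP : posmx P by apply: h1; rewrite gtr0_norm.
have nP : posmx (- (K *m P)).
  have := h2 s; rewrite gtr0_norm// => /(_ sd2).
  by rewrite scalerN scalemxAr -opprD -mulmxDr.
have uV : ursubmx P \in unitmx.
  have -> : ursubmx P = s%:M - (- ursubmx P0).
    rewrite opprK addrC /P -[in LHS](submxK P0) /N scale_block_mx add_block_mx.
    by rewrite block_mxKur scalemx1.
  move: rs; rewrite -eigenvalue_root_char; apply: contraNT => nu.
  have /det0P[v v0 vM] : \det (s%:M - - ursubmx P0) == 0.
    by move: nu; rewrite unitmxE unitfE negbK.
  apply/eigenvalueP; exists v => //.
  by move: vM; rewrite mulmxBr mul_mx_scalar => /eqP; rewrite subr_eq0 => /eqP.
pose Q := invmx P.
have uP := posmx_unit pP.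
have pQ : posmx Q by exact: posmx_inv.
have sQ : Q^T = Q by rewrite /Q trmx_inv sP.
have QP : Q *m P = 1%:M by rewrite mulVmx.
move: sP pP nP uV QP sQ pQ uP.
rewrite -[P]submxK -[Q]submxK block_mxKur.
move: (ulsubmx P) (ursubmx P) (dlsubmx P) (drsubmx P) => X V V' Z.
move: (ulsubmx Q) (ursubmx Q) (dlsubmx Q) (drsubmx Q) => Y U U' Z'.
move=> /tr_block_sym[sX -> sZ] pP nP uV QP /tr_block_sym[sY eU' sZ'] pQ uP.
move: QP pQ; rewrite {}eU' mulmx_block => e pQ.
have := e; rewrite scalar_mx_block => /eq_block_mx[e1 e2 e3 e4].
(* The upper right block of [Q *m P = 1%:M] gives [U *m Z = - (Y *m V)], where [Y] and [V] are
   invertible. *)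
have uU : U \in unitmx.
  have : U *m Z \in unitmx.
    have -> : U *m Z = - (Y *m V) by apply/eqP; rewrite -addr_eq0 addrC e2.
    rewrite -scaleN1r unitmxZ ?unitrN1// unitmx_mul uV andbT.
    exact/posmx_unit/(posmx_ul pQ).
  by rewrite unitmx_mul => /andP[].
have UW : U *m V^T = 1%:M - Y *m X by rewrite -e1 addrC addKr.
have uW : V^T \in unitmx by rewrite unitmx_tr.
pose T2 := block_mx 1%:M Y 0 U^T.
have uT2 : T2 \in unitmx by rewrite unitmxE det_ublock det1 mul1r det_tr -unitmxE.
(* The second block column of [T2] is the first one of the inverse of [P], so [P] sends it to the
   first block column of the identity. *)
have PT2 : block_mx X V V^T Z *m T2 = block_mx X 1%:M V^T 0.
  have : block_mx X V V^T Z *m block_mx Y U U^T Z' = 1%:M.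
    by apply: mulmx1C; rewrite mulmx_block.
  rewrite mulmx_block scalar_mx_block => /eq_block_mx[f1 _ f3 _].
  by rewrite mulmx_block f1 f3 !mulmx1 !mulmx0 !addr0.
pose M := Y *m A *m X + U *m Bk *m C *m X + Y *m B *m (Ck *m V^T) + U *m Ak *m V^T.
exists X, Y, (Ck *m V^T), (U *m Bk), M, U, V^T; split => //.
  split => //.
    have := posmx_cong uT2 pP; rewrite -mulmxA PT2.
    rewrite /T2 tr_block_mx trmx0 trmx1 trmxK sY mulmx_block.
    by rewrite !(mul1mx, mulmx1, mul0mx, mulmx0, addr0) e1.
  have h := posmx_cong uT2 nP; move: h.
  have -> : T2^T *m - (K *m block_mx X V V^T Z) *m T2 =
      - (T2^T *m K *m block_mx X 1%:M V^T 0).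
    by rewrite -PT2 mulmxN mulNmx !mulmxA.
  by rewrite closed_loop_congruence.
split; rewrite ?mulmxK ?mulKmx//.
have -> : M - Y *m A *m X - U *m Bk *m C *m X - Y *m B *m (Ck *m V^T) = U *m Ak *m V^T.
  by rewrite /M subr3 addrC addKr.
by rewrite -!mulmxA mulKmx// mulmxV// mulmx1.
Qed.

(** [X] is a certificate for [A] and [Y] is twice its inverse, which leaves the positive Schur
    complement [Y - invmx X = invmx X]. The choice [M = - A^T] makes the off-diagonal part skew, so
    it drops out of the form. *)
Lemma open_loop_lmi : stable_matrix A ->
  exists X Y, lmi X Y 0 0 (- A^T).
Proof.
move=> /stable_lyapunov[X [sX pX nX]]; have uX := posmx_unit pX.
pose Z := invmx X; have pZ : posmx Z by exact: posmx_inv.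
have sZ : Z^T = Z by rewrite /Z trmx_inv sX.
exists X, (Z + Z); split => //.
- by rewrite linearD/= sZ.
- have -> : block_mx X 1%:M 1%:M (Z + Z) = (block_mx 1%:M Z 0 1%:M)^T *m
      block_mx X 0 0 Z *m block_mx 1%:M Z 0 1%:M.
    rewrite tr_block_mx trmx0 trmx1 sZ !mulmx_block.
    rewrite !(mul1mx, mulmx1, mul0mx, mulmx0, addr0, add0r).
    by rewrite mulVmx// mulmxV// mul1mx.
  apply: posmx_cong; first by rewrite unitmxE det_ublock !det1 mulr1 unitr1.
  exact: posmx_block_diag.
- rewrite mulmx0 mul0mx !addr0.
  have nZ : posmx (- ((Z + Z) *m A)).
    have -> : - ((Z + Z) *m A) = Z^T *m (- (A *m X)) *m Z + Z^T *m (- (A *m X)) *m Z.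
      by rewrite mulmxN mulNmx sZ !mulmxA mulmxK// mulmxDl opprD.
    by apply: posmxD; apply: posmx_cong; rewrite // unitmx_inv.
  have e : - - A^T = - (- A)^T by rewrite [(- A)^T]linearN.
  rewrite opp_block_mx e.
  exact: (posmx_block_skew (- A) nX nZ).
Qed.

End LMI.

(** * Stability of block diagonal matrices and of segments ending at -1 *)

Section Stable.
Variable R : realType.

Lemma stable_block_diag m n (A : 'M[R]_m) (N : 'M[R]_n) :
  stable_matrix A -> stable_matrix N -> stable_matrix (block_mx A 0 0 N).
Proof.
move=> /stable_lyapunov[P [sP pP nP]] /stable_lyapunov[Q [sQ pQ nQ]].
apply: (@lyapunov_stable _ _ _ (block_mx P 0 0 Q)).
- by rewrite tr_block_mx !trmx0 sP sQ.
- exact: posmx_block_diag.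
- rewrite mulmx_block !(mul0mx, mulmx0, addr0, add0r) opp_block_mx !oppr0.
  exact: posmx_block_diag.
Qed.

(** The lower right block of a certificate for the whole matrix is one for [N]. *)
Lemma stable_block_dr m n (A : 'M[R]_m) (N : 'M[R]_n) :
  stable_matrix (block_mx A 0 0 N) -> stable_matrix N.
Proof.
move=> /stable_lyapunov[P []]; rewrite -[P]submxK.
rewrite tr_block_mx => /eq_block_mx[_ _ _ sZ] /posmx_dr pZ.
rewrite mulmx_block opp_block_mx !(mul0mx, add0r) => /posmx_dr nZ.
exact: lyapunov_stable pZ nZ.
Qed.

(** Any certificate for [N] is also one for -1, and the condition is convex in the matrix once the
    certificate is fixed. *)
Lemma stable_conv_oppr1 n (N : 'M[R]_n) t : 0 <= t <= 1 ->
  stable_matrix N -> stable_matrix ((1 - t) *: N + t *: - 1%:M).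
Proof.
move=> t01 /stable_lyapunov[P [sP pP nP]]; apply: (lyapunov_stable sP pP).
rewrite mulmxDl -!scalemxAl mulNmx mul1mx opprD -!scalerN opprK.
exact: posmx_conv.
Qed.

End Stable.

(** * Continuity of matrix operations, reduced to entries *)

Lemma continuous_compose (T U V : topologicalType) (f : T -> U) (g : U -> V) :
  continuous f -> continuous g -> continuous (fun t => g (f t)).
Proof. by move=> cf cg t; apply: continuous_comp; [exact: cf|exact: cg]. Qed.

Section Continuity.
Variables (R : realType) (T : topologicalType).

Lemma continuous_mx m n (f : T -> 'M[R]_(m, n)) :
  (forall i j, continuous (fun t => f t i j : R)) -> continuous f.
Proof.
move=> cf t U [P Pt PU].
apply: (@filterS _ (nbhs t) _ (fun s => forall i j, P i j (f s i j))).
  by move=> s h; exact: PU.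
by apply: filter_forall => i; apply: filter_forall => j; exact: cf.
Qed.

Lemma continuous_entry m n (f : T -> 'M[R]_(m, n)) i j :
  continuous f -> continuous (fun t => f t i j : R).
Proof.
move=> cf t; apply: (@continuous_comp _ _ _ f (fun M : 'M[R]_(m, n) => M i j)).
  exact: cf.
exact: coord_continuous.
Qed.

Lemma continuous_mulmx m n p (f : T -> 'M[R]_(m, n)) (g : T -> 'M[R]_(n, p)) :
  continuous f -> continuous g -> continuous (fun t => f t *m g t).
Proof.
move=> cf cg; apply: continuous_mx => i j.
under eq_fun do rewrite mxE.
move=> t; apply: (@cvg_bigsum _ _ (nbhs t)) => k.
by apply: cvgM; exact: continuous_entry.
Qed.

Lemma continuous_det n (f : T -> 'M[R]_n) :
  continuous f -> continuous (fun t => \det (f t) : R).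
Proof.
move=> cf t; apply: (@cvg_bigsum _ _ (nbhs t)) => s.
apply: cvgM; first exact: cvg_cst.
apply: (@cvg_big _ _ _ _ _ _ _ (nbhs t)) => [|i _]; first exact: mul_continuous.
exact: continuous_entry.
Qed.

(** By Cramer's formula each entry is a cofactor divided by the determinant. *)
Lemma continuous_invmx n (f : T -> 'M[R]_n) : (forall t, f t \in unitmx) ->
  continuous f -> continuous (fun t => invmx (f t)).
Proof.
move=> uf cf; apply: continuous_mx => i j.
have -> : (fun t => invmx (f t) i j) =
    (fun t => (\det (f t))^-1 * ((-1) ^+ (j + i) * \det (row' j (col' i (f t))))).
  by apply/funext => t; rewrite /invmx uf !mxE.
move=> t; apply: cvgM.
  apply: cvgV; last exact: continuous_det.
  by have := uf t; rewrite unitmxE unitfE.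
apply: cvgM; first exact: cvg_cst.
apply: continuous_det => //; apply: continuous_mx => k l.
under eq_fun do rewrite !mxE.
exact: continuous_entry.
Qed.

Lemma continuous_block_mx m1 m2 n1 n2 (f1 : T -> 'M[R]_(m1, n1))
    (f2 : T -> 'M[R]_(m1, n2)) (f3 : T -> 'M[R]_(m2, n1)) (f4 : T -> 'M[R]_(m2, n2)) :
  continuous f1 -> continuous f2 -> continuous f3 -> continuous f4 ->
  continuous (fun t => block_mx (f1 t) (f2 t) (f3 t) (f4 t)).
Proof.
move=> c1 c2 c3 c4; apply: continuous_mx => i j.
rewrite -(splitK i) -(splitK j).
case: (fintype.split i) => k; case: (fintype.split j) => l /=;
  under eq_fun do rewrite ?(block_mxEul, block_mxEur, block_mxEdl, block_mxEdr);
  exact: continuous_entry.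
Qed.

Lemma continuous_conv m n (h : T -> R) (M N : 'M[R]_(m, n)) : continuous h ->
  continuous (fun t => (1 - h t) *: M + h t *: N).
Proof.
move=> ch t; apply: cvgD; apply: cvgZr_tmp; last exact: ch.
by apply: cvgB; [exact: cvg_cst|exact: ch].
Qed.

End Continuity.

(** * Reversing and concatenating paths of matrices *)

Section Paths.
Variables (R : realType) (m n : nat).
Implicit Types (S : set 'M[R]_(m, n)) (x y z : 'M[R]_(m, n)).

(* Paths defined on all of R are concatenated by adding their clamped
   reparametrizations, which avoids any gluing. *)
Definition clamp (t : R) : R := Num.max 0 (Num.min t 1).

Lemma clamp_itv t : 0 <= clamp t <= 1.
Proof. by rewrite /clamp le_max lexx/= ge_max ler01 ge_min lexx orbT. Qed.

Lemma clamp_le0 t : t <= 0 -> clamp t = 0.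
Proof. by move=> t0; rewrite /clamp max_l// ge_min t0. Qed.

Lemma clamp_ge1 t : 1 <= t -> clamp t = 1.
Proof. by move=> t1; rewrite /clamp min_r// max_r. Qed.

Lemma continuous_clamp : continuous clamp.
Proof.
have c (a : R) : continuous (cst a : R -> R) by exact: cst_continuous.
have i : continuous (id : R -> R) by move=> t; exact: cvg_id.
exact: (max_fun_continuous (c 0) (min_fun_continuous i (c 1))).
Qed.

Definition joined S x y := exists f : R -> 'M[R]_(m, n),
  [/\ continuous f, f 0 = x, f 1 = y & forall t, 0 <= t <= 1 -> S (f t)].

Lemma joined_sym S x y : joined S x y -> joined S y x.
Proof.
move=> [f [cf f0 f1 fS]]; exists (fun t => f (1 - t)); split.
- have c : continuous (fun t : R => 1 - t).
    by move=> t; apply: cvgB; [exact: cvg_cst|exact: cvg_id].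
  exact: continuous_compose c cf.
- by rewrite subr0.
- by rewrite subrr.
- by move=> t /andP[t0 t1]; apply: fS; rewrite subr_ge0 t1 gerBl.
Qed.

Lemma joined_trans S x y z : joined S x y -> joined S y z -> joined S x z.
Proof.
move=> [f [cf f0 f1 fS]] [g [cg g0 g1 gS]].
(* On the first half the [g] term stays at [y], on the second half the [f] term does; subtracting
   [y] leaves the moving path. *)
exists (fun t => f (clamp (2 * t)) + g (clamp (2 * t - 1)) - y); split.
- have c2 : continuous (fun t : R => 2 * t).
    by move=> t; apply: cvgM; [exact: cvg_cst|exact: cvg_id].
  have c21 : continuous (fun t : R => 2 * t - 1).
    by move=> t; apply: cvgB; [exact: c2|exact: cvg_cst].
  have cf2 := continuous_compose (continuous_compose c2 continuous_clamp) cf.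
  have cg2 := continuous_compose (continuous_compose c21 continuous_clamp) cg.
  move=> t; apply: cvgB; last exact: cvg_cst.
  by apply: cvgD; [exact: cf2|exact: cg2].
- by rewrite mulr0 !clamp_le0 ?sub0r ?lerN10// f0 g0 addrK.
- by rewrite mulr1 !clamp_ge1 ?f1 ?g1; [rewrite addrC addKr|lra|lra].
- move=> t t01; case: (leP (2 * t) 1) => h.
    rewrite (@clamp_le0 (2 * t - 1)) ?subr_le0// g0 addrK.
    exact/fS/clamp_itv.
  rewrite (@clamp_ge1 (2 * t)) ?ltW// f1 addrC addKr.
  exact/gS/clamp_itv.
Qed.

Lemma joined_segment S x y :
  (forall t, 0 <= t <= 1 -> S ((1 - t) *: x + t *: y)) -> joined S x y.
Proof.
move=> h; exists (fun t => (1 - t) *: x + t *: y); split => //.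
- by apply: continuous_conv => t; exact: cvg_id.
- by rewrite subr0 scale1r scale0r addr0.
- by rewrite subrr scale1r scale0r add0r.
Qed.

Lemma path_connected_joined S z :
  (forall x, S x -> joined S x z) -> path_connected R S.
Proof.
move=> Sz x y Sx Sy.
have [f [cf f0 f1 fS]] := joined_trans (Sz x Sx) (joined_sym (Sz y Sy)).
by exists f; split => //; exact: continuous_subspaceT.
Qed.

End Paths.

(** * Joining every stabilizing controller to a decoupled one *)

Section Connect.
Variables (R : realType) (n m p : nat).
Variables (A : 'M[R]_n) (B : 'M[R]_(n, m)) (C : 'M[R]_(p, n)).
Hypothesis hA : stable_matrix A.
Local Notation S := (stabilizing_controllers A B C).

Lemma decoupled_stabilizing (N : 'M[R]_n) : stable_matrix N ->
  S (block_mx 0 0 0 N).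
Proof.
move=> sN; exists N, 0, 0; split => //; rewrite mulmx0 mul0mx.
exact: stable_block_diag.
Qed.

Lemma joined_decoupled K : S K ->
  exists2 N : 'M[R]_n, stable_matrix N & joined S K (block_mx 0 0 0 N).
Proof.
move=> [Ak [Bk [Ck [-> sK]]]].
have [X [Y [F [H [M [U [W [hl uU UW [-> -> ->]]]]]]]]] := stable_lmi sK.
have [X1 [Y1 hl1]] := open_loop_lmi B C hA.
(* Clamping makes the convex inequality, and hence the invertibility of [Wt t], hold for every real
   [t], as continuity on the whole line demands. *)
pose cv a b (P Q : 'M[R]_(a, b)) t := (1 - clamp t) *: P + clamp t *: Q.
pose Xt := cv _ _ X X1; pose Yt := cv _ _ Y Y1; pose Ft := cv _ _ F 0.
pose Ht := cv _ _ H 0; pose Mt := cv _ _ M (- A^T).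
(* With [U] fixed, this is the only [Wt t] satisfying [U *m Wt t = 1%:M - Yt t *m Xt t]; it equals
   [W] at 0. *)
pose Wt t := invmx U *m (1%:M - Yt t *m Xt t).
pose Nt t := invmx U *m (Mt t - Yt t *m A *m Xt t - Ht t *m C *m Xt t -
  Yt t *m B *m Ft t) *m invmx (Wt t).
have hlt t : lmi A B C (Xt t) (Yt t) (Ft t) (Ht t) (Mt t).
  by apply: lmi_conv => //; exact: clamp_itv.
have UWt t : U *m Wt t = 1%:M - Yt t *m Xt t by rewrite /Wt mulKVmx.
have uWt t : Wt t \in unitmx.
  have [_ _ pXY _] := hlt t; have := subYX_unit pXY.
  by rewrite -(UWt t) unitmx_mul uU.
have sKt t := lmi_stable (hlt t) uU (UWt t).
have cv0 a b (P Q : 'M[R]_(a, b)) : cv _ _ P Q 0 = P.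
  by rewrite /cv clamp_le0// subr0 scale1r scale0r addr0.
have cv1 a b (P Q : 'M[R]_(a, b)) : cv _ _ P Q 1 = Q.
  by rewrite /cv clamp_ge1// subrr scale1r scale0r add0r.
have F1 : Ft 1 = 0 by exact: cv1.
have H1 : Ht 1 = 0 by exact: cv1.
(* At the endpoint [F] and [H] vanish, so the closed loop is block diagonal and its lower right
   block [Nt 1] is stable. *)
exists (Nt 1).
  have := sKt 1; rewrite -/(Nt 1).
  have -> : B *m (Ft 1 *m invmx (Wt 1)) = 0 by rewrite F1 mul0mx mulmx0.
  have -> : invmx U *m Ht 1 *m C = 0 by rewrite H1 mulmx0 mul0mx.
  exact: stable_block_dr.
exists (fun t => block_mx 0 (Ft t *m invmx (Wt t)) (invmx U *m Ht t) (Nt t)); split.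
- have ccv a b (P Q : 'M[R]_(a, b)) : continuous (cv _ _ P Q).
    by apply: continuous_conv; exact: continuous_clamp.
  have cX : continuous Xt by exact: ccv.
  have cY : continuous Yt by exact: ccv.
  have cF : continuous Ft by exact: ccv.
  have cH : continuous Ht by exact: ccv.
  have cM : continuous Mt by exact: ccv.
  have cst a b (P : 'M[R]_(a, b)) : continuous (fun _ : R => P).
    by move=> t; exact: cvg_cst.
  have cB a b (f g : R -> 'M[R]_(a, b)) : continuous f -> continuous g ->
      continuous (fun t => f t - g t).
    by move=> cf cg t; apply: cvgB; [exact: cf|exact: cg].
  have cW : continuous (fun t => invmx (Wt t)).
    apply: continuous_invmx => //; apply: continuous_mulmx => //.
    exact: (cB _ _ _ _ (cst _ _ _) (continuous_mulmx cY cX)).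
  have cN : continuous Nt.
    apply: (continuous_mulmx _ cW); apply: (continuous_mulmx (cst _ _ _)).
    apply: (cB _ _ _ _ _ (continuous_mulmx (continuous_mulmx cY (cst _ _ B)) cF)).
    apply: (cB _ _ _ _ _ (continuous_mulmx (continuous_mulmx cH (cst _ _ C)) cX)).
    exact: (cB _ _ _ _ cM (continuous_mulmx (continuous_mulmx cY (cst _ _ A)) cX)).
  exact: (continuous_block_mx (cst _ _ 0) (continuous_mulmx cF cW)
    (continuous_mulmx (cst _ _ _) cH) cN).
- have W0 : Wt 0 = W by rewrite /Wt /Xt /Yt !cv0 -UW mulKmx.
  by rewrite /Nt W0 /Xt /Yt /Ft /Ht /Mt !cv0.
- by rewrite F1 H1 mul0mx mulmx0.
- move=> t _; exists (Nt t), (invmx U *m Ht t), (Ft t *m invmx (Wt t)).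
  by split; [reflexivity|exact: (sKt t)].
Qed.

End Connect.

Theorem corollary3p1 (R : realType) (n m p : nat)
    (hn : (1 <= n)%N) (hm : (1 <= m)%N) (hp : (1 <= p)%N)
    (A : 'M[R]_n) (B : 'M[R]_(n, m)) (C : 'M[R]_(p, n))
    (W : 'M[R]_n) (V : 'M[R]_p) (Q : 'M[R]_n) (Rw : 'M[R]_m)
    (hW : psdmx W) (hV : pdmx V) (hQ : psdmx Q) (hR : pdmx Rw)
    (hAB : controllable A B) (hAW : controllable A (sqrtmx W))
    (hCA : observable C A) (hQA : observable (sqrtmx Q) A)
    (hA : stable_matrix A) :
  path_connected R (stabilizing_controllers A B C).
Proof.
(* All controllers are joined to a common base point, the decoupled one with [AK = - 1%:M]: first to
   some decoupled controller, then along a segment in [AK]. *)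
apply: (@path_connected_joined _ _ _ _ (block_mx 0 0 0 (- 1%:M))) => K.
move=> /(joined_decoupled hA)[N sN KN]; apply: (joined_trans KN).
apply: joined_segment => t t01.
rewrite !scale_block_mx add_block_mx !scaler0 !addr0.
exact/(decoupled_stabilizing _ _ hA)/stable_conv_oppr1.
Qed.
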